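(* Let $n\ge2$, $\gamma\in\,]0,1]$, $p\in[1,\infty[$, and let $\Omega$ be a bounded domain in $\mathbb{R}^n$. Assume that there exists $c_0>0$ such that $|B_\gamma(x,r)\cap\Omega|\ge c_0 r^{n_\gamma}$ for all $x\in\overline\Omega$ and all $0<r\le \operatorname{diam}_{\delta_\gamma}\Omega$. Assume moreover that there are constants $\tau\ge1$, $\tilde\eta>0$ and $c_p>0$ such that the Poincaré inequality $$\frac{1}{|\Omega\cap B_\gamma(x,r)|}\int_{\Omega\cap B_\gamma(x,r)}\bigl|f-f_{\Omega\cap B_\gamma(x,r)}\bigr|\,dy\le c_p\, r^{\tilde\eta}\left(\frac{1}{|\Omega\cap B_\gamma(x,\tau r)|}\int_{\Omega\cap B_\gamma(x,\tau r)}|\nabla f|^p\,dy\right)^{1/p}$$ holds for all $f\in W^1_p(\Omega)$, all $x\in\Omega$ and all $r>0$, where $f_E=\frac{1}{|E|}\int_E f$. Let $\lambda>0$ satisfy $p\tilde\eta>n_\gamma-\lambda$. Then there exists $c>0$ such that for every $f\in W^{1,\lambda}_{p,\gamma}(\Omega)$ (identified with its continuous representative) and all $x,y\in\Omega$, $$|f(x)-f(y)|\le c\,\|f\|_{W^{1,\lambda}_{p,\gamma}(\Omega)}\bigl(|\bar x-\bar y|^\gamma+|x_n-y_n|\bigr)^{\tilde\eta+\frac{\lambda-n_\gamma}{p}} .$$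
   Context: Points of $\mathbb{R}^n$ are written $x=(\bar x,x_n)$, $\bar x\in\mathbb{R}^{n-1}$. $\delta_\gamma(x,y)=\max\{|\bar x-\bar y|^\gamma,|x_n-y_n|\}$, $B_\gamma(x,r)=\{y:\delta_\gamma(x,y)<r\}$, $\operatorname{diam}_{\delta_\gamma}\Omega$ is the diameter of $\Omega$ in the metric $\delta_\gamma$, and $n_\gamma=\frac{n-1}{\gamma}+1$. For $\lambda\ge0$ and $g\in L^p(\Omega)$, $\|g\|_{L^\lambda_{p,\gamma}(\Omega)}=\sup_{x\in\Omega}\sup_{r>0}\bigl(\frac{1}{\min\{r^\lambda,1\}}\int_{B_\gamma(x,r)\cap\Omega}|g|^p\bigr)^{1/p}$, and $L^\lambda_{p,\gamma}(\Omega)$ is the space where this is finite. For $l\in\mathbb{N}$, $W^{l,\lambda}_{p,\gamma}(\Omega)=\{f\in L^p(\Omega): D^\alpha f\in L^\lambda_{p,\gamma}(\Omega)\ \forall |\alpha|\le l\}$ with norm $\sum_{|\alpha|\le l}\|D^\alpha f\|_{L^\lambda_{p,\gamma}(\Omega)}$ (weak derivatives). *)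

(* Defs.v *)
From HB Require Import structures.
From mathcomp Require Import all_boot all_order all_algebra.
From mathcomp Require Import all_classical all_reals all_analysis.
Set Implicit Arguments. Unset Strict Implicit. Unset Printing Implicit Defensive.
Import Order.TTheory GRing.Theory Num.Theory.
Import numFieldNormedType.Exports.
Local Open Scope classical_set_scope.
Local Open Scope ring_scope.

(* ---- R^n as row vectors, with the sigma-algebra generated by the coordinates
   (= Borel sigma-algebra of R^n) ---- *)
Section measurable_rV.
Context {R : realType} (n : nat).
Let coors : 'I_n -> 'rV[R]_n -> R := fun i x => x ord0 i.
Let rV_set0 : g_sigma_preimage coors set0.
Proof. exact: sigma_algebra0. Qed.
Let rV_setC A : g_sigma_preimage coors A -> g_sigma_preimage coors (~` A).
Proof. exact: sigma_algebraC. Qed.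
Let rV_bigcup (F : _^nat) : (forall i, g_sigma_preimage coors (F i)) ->
  g_sigma_preimage coors (\bigcup_i (F i)).
Proof. exact: sigma_algebra_bigcup. Qed.
HB.instance Definition _ := @isMeasurable.Build
  (measure_tuple_display default_measure_display)
  'rV[R]_n (g_sigma_preimage coors) rV_set0 rV_setC rV_bigcup.
End measurable_rV.

Section defs.
Context {R : realType} (n : nat).
Local Notation Rn := 'rV[R]_n.

(* mu is the n-dimensional Lebesgue measure: it gives half-open boxes their
   volume (this determines it uniquely on the Borel sets). *)
Definition is_lebesgue_Rn (mu : {measure set Rn -> \bar R}) : Prop :=
  forall a b : Rn, (forall i, a ord0 i <= b ord0 i) ->
    mu [set x | forall i, a ord0 i <= x ord0 i < b ord0 i] =
    (\prod_(i < n) (b ord0 i - a ord0 i))%:E.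

(* x = (xbar, x_n): the last coordinate has index n-1 *)
Definition xlast (x : Rn) : R := \sum_(i < n | val i == n.-1) x ord0 i.
Definition bar_dist (x y : Rn) : R :=
  Num.sqrt (\sum_(i < n | val i != n.-1) (x ord0 i - y ord0 i) ^+ 2).

Definition delta_g (g : R) (x y : Rn) : R :=
  Num.max (bar_dist x y `^ g) `|xlast x - xlast y|.
Definition ball_g (g : R) (x : Rn) (r : R) : set Rn :=
  [set y | delta_g g x y < r].
Definition diam_g (g : R) (O : set Rn) : R :=
  sup [set delta_g g x y | x in O & y in O].
Definition n_g (g : R) : R := (n.-1)%:R / g + 1.

Definition pderiv (i : 'I_n) (phi : Rn -> R) : Rn -> R :=
  fun x => derive phi x (delta_mx ord0 i).
Definition iter_pderiv (s : seq 'I_n) (phi : Rn -> R) : Rn -> R :=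
  foldr pderiv phi s.

Definition smooth (phi : Rn -> R) : Prop :=
  forall s : seq 'I_n, continuous (iter_pderiv s phi) /\
    forall (i : 'I_n) (x : Rn), derivable (iter_pderiv s phi) x (delta_mx ord0 i).

Definition test_fun (O : set Rn) (phi : Rn -> R) : Prop :=
  smooth phi /\ compact (closure [set x | phi x != 0]) /\
  closure [set x | phi x != 0] `<=` O.

Variable mu : {measure set Rn -> \bar R}.

Definition Lp (p : R) (O : set Rn) (f : Rn -> R) : Prop :=
  measurable_fun O f /\ (\int[mu]_(x in O) (`|f x| `^ p)%:E < +oo)%E.

Definition weak_grad (O : set Rn) (f : Rn -> R) (g : 'I_n -> Rn -> R) : Prop :=
  forall (i : 'I_n) (phi : Rn -> R), test_fun O phi ->
    (\int[mu]_(x in O) (f x * pderiv i phi x)%:E =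
     - \int[mu]_(x in O) (g i x * phi x)%:E)%E.

Definition W1p (p : R) (O : set Rn) (f : Rn -> R) (g : 'I_n -> Rn -> R) : Prop :=
  Lp p O f /\ (forall i, Lp p O (g i)) /\ weak_grad O f g.

Definition grad_norm (g : 'I_n -> Rn -> R) (x : Rn) : R :=
  Num.sqrt (\sum_(i < n) (g i x) ^+ 2).

Definition meas (E : set Rn) : R := fine (mu E).
Definition avg (E : set Rn) (f : Rn -> R) : R :=
  (meas E)^-1 * Rintegral mu E f.

Definition morrey_norm (lam p gam : R) (O : set Rn) (h : Rn -> R) : \bar R :=
  ereal_sup [set poweR
      ((Num.min (r `^ lam) 1)^-1%:E *
       \int[mu]_(y in ball_g gam x r `&` O) (`|h y| `^ p)%:E)%E p^-1
    | x in O & r in [set r : R | 0 < r]].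

Definition in_morrey (lam p gam : R) (O : set Rn) (h : Rn -> R) : Prop :=
  Lp p O h /\ (morrey_norm lam p gam O h < +oo)%E.

Definition in_W1lam (lam p gam : R) (O : set Rn) (f : Rn -> R)
    (g : 'I_n -> Rn -> R) : Prop :=
  weak_grad O f g /\ in_morrey lam p gam O f /\
  forall i, in_morrey lam p gam O (g i).

Definition W1lam_norm (lam p gam : R) (O : set Rn) (f : Rn -> R)
    (g : 'I_n -> Rn -> R) : \bar R :=
  (morrey_norm lam p gam O f + \sum_(i < n) morrey_norm lam p gam O (g i))%E.

End defs.

(* Main.v *)
Require Import Defs.
From HB Require Import structures.
From mathcomp Require Import all_boot all_order all_algebra.
From mathcomp Require Import all_classical all_reals all_analysis.
From mathcomp Require Import measurable_realfun ring lra.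
Import Order.TTheory GRing.Theory Num.Theory.
Import numFieldNormedType.Exports.
Local Open Scope classical_set_scope.
Local Open Scope ring_scope.

(* The Poincare inequality, the Morrey bound on the gradient and the lower
   volume bound say that the mean oscillation of f over E(x, r) = Omega /\
   B_gamma(x, r) is at most A r^th with th = eta + (lambda - n_gamma) / p > 0
   (a Campanato condition).  As r is halved, the means of f over E(x, r) thus
   form a geometrically convergent family; its limit f'(x) is Holder continuous,
   by comparing E(y, d) with E(x, 4 d) when d = delta_gamma(x, y).  No Lebesgue
   differentiation theorem is needed for f' = f a.e.: cover Omega by the sets
   E(x_i, r) centred at a maximal r-separated set, so that the sum of their
   measures is O(1); Markov's inequality on each of them bounds the measure of
   {|f - f'| >= eps} by a constant times r^th / eps, for every small r. *)

(** * Means over sets of finite measure, Markov's inequality, null sets *)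

Section mean_values.
Context (d : measure_display) (T : measurableType d) (R : realType).
Context (mu : {measure set T -> \bar R}).
Implicit Types (E F : set T) (f : T -> R).

(* [avg] of the statement on an arbitrary measure space *)
Definition mean E f : R := (fine (mu E))^-1 * Rintegral mu E f.

Lemma mean_ge0 E f : (forall x, E x -> 0 <= f x) -> 0 <= mean E f.
Proof.
move=> f0; apply: mulr_ge0; last exact: Rintegral_ge0.
by rewrite invr_ge0 fine_ge0.
Qed.

Lemma integrable_cst_fin E (a : R) : measurable E -> (mu E < +oo)%E ->
  mu.-integrable E (EFin \o cst a).
Proof.
move=> mE Efin; apply/integrableP; split; first exact/measurable_EFinP/measurable_cst.
rewrite (_ : (fun x => _) = cst (`|a|%:E)); last exact/funext.
by rewrite integral_cst// lte_mul_pinfty// lee_fin.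
Qed.

Lemma integrable_subC E f (b : R) : measurable E -> (mu E < +oo)%E ->
  mu.-integrable E (EFin \o f) -> mu.-integrable E (EFin \o (fun y => f y - b)).
Proof.
move=> mE Efin fi.
have := integrableB mE fi (integrable_cst_fin E b mE Efin).
by congr (mu.-integrable _ _); apply/funext => x /=; rewrite EFinB.
Qed.

Lemma fin_num_measure_sub E F : measurable E -> measurable F -> F `<=` E ->
  (mu E < +oo)%E -> mu F \is a fin_num.
Proof.
move=> mE mF FE Efin; rewrite ge0_fin_numE//.
by apply: le_lt_trans Efin; apply: le_measure; rewrite ?inE.
Qed.

Lemma le_fine_measure E F : measurable E -> measurable F -> F `<=` E ->
  (mu E < +oo)%E -> fine (mu F) <= fine (mu E).
Proof.
move=> mE mF FE Efin; apply: fine_le.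
- exact: (fin_num_measure_sub E).
- exact: (fin_num_measure_sub E).
- by apply: le_measure; rewrite ?inE.
Qed.

Lemma le_Rintegral_set E F f : measurable E -> measurable F -> F `<=` E ->
  mu.-integrable E (EFin \o f) -> (forall x, E x -> 0 <= f x) ->
  Rintegral mu F f <= Rintegral mu E f.
Proof.
move=> mE mF FE fi f0; apply: fine_le.
- exact: (integrable_fin_num mF (integrableS mE mF FE fi)).
- exact: (integrable_fin_num mE fi).
- apply: ge0_subset_integral => //; first exact: measurable_int fi.
Qed.

(** As [b] is its own mean over [F], the left side is the modulus of the mean of [f - b] over [F].
    Integrating over the larger [E] instead costs the ratio of the two measures, which is at most
    [k]. *)
Lemma mean_sub_le E F f (b k : R) : measurable E -> measurable F ->
  F `<=` E -> (mu E < +oo)%E -> mu.-integrable E (EFin \o f) ->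
  0 < fine (mu F) -> fine (mu E) <= k * fine (mu F) ->
  `|mean F f - b| <= k * mean E (fun y => `|f y - b|).
Proof.
move=> mE mF FE Efin fi F0 EkF.
have Ffin : (mu F < +oo)%E by rewrite -ge0_fin_numE//; exact: (fin_num_measure_sub E).
have fiF := integrableS mE mF FE fi.
have E0 : 0 < fine (mu E) by rewrite (lt_le_trans F0)// le_fine_measure.
have -> : mean F f - b = mean F (fun y => f y - b).
  rewrite /mean RintegralB//; last exact: integrable_cst_fin.
  by rewrite Rintegral_cst// mulrBr mulrCA mulVf ?gt_eqF// mulr1.
rewrite /mean normrM ger0_norm ?invr_ge0 ?fine_ge0//.
have h : `|Rintegral mu F (fun y => f y - b)|
    <= Rintegral mu E (fun y => `|f y - b|).
  apply: (le_trans (le_normr_Rintegral mF (integrable_subC F f b mF Ffin fiF))).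
  apply: le_Rintegral_set => //.
  exact: (integrable_norm (integrable_subC E f b mE Efin fi)).
rewrite mulrA ler_pM// ?invr_ge0 ?fine_ge0//.
by rewrite -(ler_pM2l F0) mulfV ?gt_eqF// mulrA ler_pdivlMr// mul1r mulrC.
Qed.

Lemma markov_mean E f (b e : R) : measurable E -> (mu E < +oo)%E ->
  0 < fine (mu E) -> mu.-integrable E (EFin \o f) -> 0 < e ->
  (mu (E `&` [set x | (e <= `|f x - b|)%R])
    <= (e^-1 * fine (mu E) * mean E (fun y => `|f y - b|))%:E)%E.
Proof.
move=> mE Efin E0 fi e0.
have fb := integrable_subC E f b mE Efin fi.
have := le_integral_comp_abse mu mE (@measurable_id _ _ _) (fun _ => id)
  (fun _ _ _ _ => id) (measurable_int mu fb) e0.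
rewrite /= => h.
rewrite /mean -mulrA mulVKf ?gt_eqF// EFinM lee_pdivlMl//.
rewrite /Rintegral fineK; last exact: (integrable_fin_num mE (integrable_norm fb)).
exact: h.
Qed.

(** [A] itself may be nonmeasurable: measurable supersets [U k] of measure at most 1 / (k + 1) are
    intersected into a measurable null set containing [A]. *)
Lemma negligible_small A : (forall e : R, 0 < e ->
  exists U, [/\ measurable U, A `<=` U & (mu U <= e%:E)%E]) -> mu.-negligible A.
Proof.
move=> H.
have /choice[U HU] (k : nat) : exists U, [/\ measurable U, A `<=` U &
    (mu U <= (k.+1%:R^-1)%:E)%E] by apply: H; rewrite invr_gt0.
have mU : measurable (\bigcap_k U k).
  by apply: bigcap_measurable => // k _; case: (HU k).
exists (\bigcap_k U k); split => //; last first.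
  by move=> x Ax k _; case: (HU k) => _ + _; exact.
have Uk k : (mu (\bigcap_k U k) <= (k.+1%:R^-1)%:E)%E.
  case: (HU k) => mUk _; apply: le_trans.
  by apply: le_measure; rewrite ?inE//; exact: bigcap_inf.
apply/eqP; rewrite eq_le measure_ge0 andbT.
apply/lee_addgt0Pr => e e0; rewrite add0e.
have [k ke] : exists k, k.+1%:R^-1 < e.
  exists (Num.truncn e^-1); rewrite invf_plt ?posrE//.
  by rewrite truncnS_gt.
by apply: (le_trans (Uk k)); rewrite lee_fin ltW.
Qed.

End mean_values.
Arguments mean {d T R} mu E f.

(** * Campanato's embedding for a quasi-metric whose balls in [O] have measure comparable to r^nu *)

Section campanato.
Context (d : measure_display) (T : measurableType d) (R : realType).
Context (mu : {measure set T -> \bar R}) (O : set T) (dist : T -> T -> R).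
Context (R0 c C nu th : R).
Context (mO : measurable O) (Ofin : (mu O < +oo)%E).
Context (R0_gt0 : 0 < R0) (c_gt0 : 0 < c) (C_gt0 : 0 < C).
Context (nu_gt0 : 0 < nu) (th_gt0 : 0 < th).
Context (distC : forall x y, dist x y = dist y x).
Context (dist_quasi : forall x y z,
  dist x z <= 2 * Num.max (dist x y) (dist y z)).
Context (mball : forall x (r : R), measurable [set y | dist x y < r]).

Let E x r := O `&` [set y | dist x y < r].

Context (ball_lower : forall x (r : R), O x -> 0 < r -> r <= R0 ->
  c * r `^ nu <= fine (mu (E x r))).
Context (ball_upper : forall x (r : R), O x -> 0 < r -> r <= R0 ->
  fine (mu (E x r)) <= C * r `^ nu).

Let mE x r : measurable (E x r). Proof. exact: measurableI. Qed.
Let EO x r : E x r `<=` O. Proof. exact: subIsetl. Qed.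
Let Efin x r : (mu (E x r) < +oo)%E.
Proof. by rewrite -ge0_fin_numE//; apply: (fin_num_measure_sub _ _ _ mu O). Qed.
Let E_gt0 x r : O x -> 0 < r -> r <= R0 -> 0 < fine (mu (E x r)).
Proof.
move=> Ox r0 rR; rewrite (lt_le_trans _ (ball_lower x r Ox r0 rR))//.
by rewrite mulr_gt0 ?powR_gt0.
Qed.

(** The quasi-triangle inequality yields only [dist x z <= 2 * s], since [dist x y = s] is allowed;
    the factor 4 restores the strict inequality defining a ball. *)
Lemma ball_sub x y (s : R) : dist x y <= s -> 0 < s -> E y s `<=` E x (4 * s).
Proof.
move=> xys s0 z [Oz /= yz]; split => //=.
apply: (le_lt_trans (dist_quasi x y z)).
have : Num.max (dist x y) (dist y z) <= s by rewrite ge_max xys ltW.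
lra.
Qed.

(** Disjoint balls of radius r / 2, each of measure at least c (r / 2)^nu, have total measure at
    most that of [O]. This bounds the size of every [r]-separated family, and a maximal one covers
    [O]. By the last inequality the measures of the covering balls have a sum bounded independently
    of [r]. *)
Lemma separated_net (r : R) : 0 < r -> r <= R0 -> O !=set0 ->
  exists N (x : nat -> T), [/\ forall i, (i < N)%N -> O (x i),
    O `<=` \big[setU/set0]_(i < N) E (x i) r &
    N%:R * r `^ nu <= 2 `^ nu / c * fine (mu O)].
Proof.
move=> r0 rR [x0 Ox0].
pose P N := exists x : nat -> T, (forall i, (i < N)%N -> O (x i)) /\
  forall i j, (i < j < N)%N -> r <= dist (x i) (x j).
have r20 : 0 < r / 2 by rewrite divr_gt0.
have r2R : r / 2 <= R0 by lra.
(* the balls of radius r / 2 around r-separated points are disjoint *)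
have bnd N : P N -> N%:R * r `^ nu <= 2 `^ nu / c * fine (mu O).
  move=> [x [xO xs]].
  have tI : trivIset [set: 'I_N] (fun i : 'I_N => E (x i) (r / 2)).
    suff H (i j : 'I_N) : (i < j)%N ->
        E (x i) (r / 2) `&` E (x j) (r / 2) !=set0 -> False.
      move=> i j _ _ ne; case: (ltngtP (val i) (val j)) => [ij|ji|/val_inj//].
        by case: (H _ _ ij ne).
      by rewrite setIC in ne; case: (H _ _ ji ne).
    move=> ij [z [[_ /= iz] [_ /= jz]]].
    have := xs i j; rewrite ij ltn_ord => /(_ isT).
    apply/negP; rewrite -ltNge.
    apply: (le_lt_trans (dist_quasi _ z _)).
    have : Num.max (dist (x i) z) (dist z (x j)) < r / 2.
      by rewrite gt_max iz distC jz.
    lra.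
  have : (\sum_(i < N) mu (E (x i) (r / 2)%R) <= mu O)%E.
    rewrite -(measure_bigsetU_ord mu xpredT)//.
    apply: le_measure; rewrite ?inE//; first exact: bigsetU_measurable.
    by rewrite -(bigcup_mkord N (fun i => E (x i) (r / 2))) => y [i _ []].
  have -> : (\sum_(i < N) mu (E (x i) (r / 2)%R))%E =
      (\sum_(i < N) fine (mu (E (x i) (r / 2))))%:E.
    by rewrite -sumEFin; apply: eq_bigr => i _; rewrite fineK// ge0_fin_numE.
  have Of : mu O \is a fin_num by rewrite ge0_fin_numE.
  rewrite -[X in (_ <= X)%E -> _](fineK Of) lee_fin => h.
  have h2 : N%:R * (c * (r / 2) `^ nu) <= fine (mu O).
    rewrite mulr_natl -[in leLHS](card_ord N) -sumr_const.
    by apply: le_trans h; apply: ler_sum => i _; apply: ball_lower => //; exact: xO.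
  have -> : r `^ nu = 2 `^ nu / c * (c * (r / 2) `^ nu).
    rewrite mulrA divfK ?gt_eqF// -powRM ?(ltW r20)//; congr (_ `^ _).
    by rewrite mulrCA mulfV ?mulr1.
  rewrite mulrCA; apply: ler_wpM2l; last exact: h2.
  by rewrite divr_ge0 ?powR_ge0// ltW.
(* The empty family gives [P 0], and [bnd] bounds all admissible sizes, so a largest one exists. *)
have ex : exists N, `[< P N >].
  by exists 0%N; apply/asboolP; exists (fun=> x0); split => // i j; rewrite ltn0 andbF.
have [M bM] : exists M, forall N, `[< P N >] -> (N <= M)%N.
  exists (Num.truncn (2 `^ nu / c * fine (mu O) / r `^ nu)) => m /asboolP /bnd.
  by rewrite -ler_pdivlMr ?powR_gt0// => h; rewrite truncn_ge_nat// (le_trans _ h).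
case: (ex_maxnP ex bM) => N /asboolP PN maxN.
have [x [xO xs]] := PN.
exists N, x; split => //; last exact: bnd.
move=> z Oz; rewrite -(bigcup_mkord N (fun i => E (x i) r)).
(* A point [z] outside every ball is at distance at least [r] from each [x i]; placed at index [N]
   it would give [P N.+1], against maximality. *)
apply: contrapT => nz.
suff : (N.+1 <= N)%N by rewrite ltnn.
apply: maxN; apply/asboolP.
exists (fun i => if (i < N)%N then x i else z); split.
  by move=> i; case: ifPn => // iN _; exact: xO.
move=> i j /andP[ij]; rewrite ltnS leq_eqVlt => /predU1P[jN|jN].
  rewrite jN ltnn -jN ij leNgt; apply/negP => h; apply: nz.
  by exists i => //=; rewrite -jN.
by rewrite jN (ltn_trans ij jN) xs// ij jN.
Qed.

Context (f : T -> R) (A : R).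
Context (f_int : mu.-integrable O (EFin \o f)) (A_ge0 : 0 <= A).

Let a x r := mean mu (E x r) f.

Context (osc : forall x (r : R), O x -> 0 < r -> r <= R0 ->
  mean mu (E x r) (fun y => `|f y - a x r|) <= A * r `^ th).

Let fiE x r : mu.-integrable (E x r) (EFin \o f).
Proof. exact: (integrableS mO). Qed.

(** Bounds the ratio of the measures of a ball of radius [r] and a ball of radius [s] whenever
    [r <= 4 * s]. *)
Definition step_const := C / c * 4 `^ nu.
Local Notation K1 := step_const.
Definition chain_const := K1 / (1 - 2^-1 `^ th).
Local Notation K2 := chain_const.
(** One term for each leg of the path from [u x] to the mean over [E x (4 * s)], on to the mean over
    [E y s], and then to [u y]. *)
Definition holder_const := K2 * 4 `^ th + K1 * 4 `^ th + K2.
Local Notation K3 := holder_const.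

Let K1_gt0 : 0 < K1. Proof. by rewrite mulr_gt0 ?powR_gt0 ?divr_gt0. Qed.

Let half_lt1 : 2^-1 `^ th < 1 :> R.
Proof.
suff : 2^-1 `^ th < 1 `^ th :> R by rewrite powR1.
by apply: gt0_ltr_powR; rewrite ?nnegrE//; lra.
Qed.

Let K2_gt0 : 0 < K2. Proof. by rewrite divr_gt0// subr_gt0. Qed.

Let leK12 : K1 <= K2.
Proof.
rewrite ler_pdivlMr ?subr_gt0// ger_pMr// gerBl powR_ge0//.
Qed.

Lemma holder_const_gt0 : 0 < K3.
Proof.
by apply: addr_gt0 => //; apply: addr_gt0; apply: mulr_gt0 => //; exact: powR_gt0.
Qed.

Let K2A_ge0 (t : R) : 0 <= K2 * A * t `^ th.
Proof.
apply: mulr_ge0; last exact: powR_ge0.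
by apply: mulr_ge0 => //; exact: ltW.
Qed.

Let le_powR (t r s : R) : 0 <= t -> 0 <= r -> r <= s -> r `^ t <= s `^ t.
Proof. by move=> ? r0 rs; apply: ge0_ler_powR; rewrite ?nnegrE// (le_trans r0). Qed.

(** By the two volume bounds the ratio of the measures is at most [K1], so [mean_sub_le] reduces the
    claim to [osc]. The case y = x serves to shrink the radius, the general case to change the
    centre. *)
Lemma mean_step x y (r s : R) : O x -> O y -> 0 < s -> s <= r -> r <= R0 ->
  r <= 4 * s -> E y s `<=` E x r -> `|a y s - a x r| <= K1 * A * r `^ th.
Proof.
move=> Ox Oy s0 sr rR rs sub.
have r0 : 0 < r by exact: lt_le_trans sr.
have sR : s <= R0 by exact: le_trans rR.
rewrite -mulrA.
apply: (@le_trans _ _ (K1 * mean mu (E x r) (fun z => `|f z - a x r|))).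
  apply: mean_sub_le => //; first exact: E_gt0.
  apply: (le_trans (ball_upper x r Ox r0 rR)).
  apply: (@le_trans _ _ (C * (4 * s) `^ nu)).
    by rewrite ler_pM2l// le_powR// ltW.
  rewrite powRM ?(ltW s0)// (_ : C * _ = K1 * (c * s `^ nu)).
    by rewrite ler_pM2l//; exact: ball_lower.
  by rewrite /K1; field; rewrite gt_eqF.
by rewrite ler_pM2l//; exact: osc.
Qed.

(* [chain_const] is chosen so that K2 2^-th + K1 = K2, which closes the induction on the
   number of halvings leading from r down to s. *)
Lemma mean_chain x (r s : R) : O x -> 0 < s -> s <= r -> r <= R0 ->
  `|a x s - a x r| <= K2 * A * r `^ th.
Proof.
move=> Ox s0 sr rR.
have [k] : exists k, r <= 2 ^+ k * s.
  exists (Num.truncn (r / s)).+1; rewrite -ler_pdivrMr//.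
  apply: (@le_trans _ _ ((Num.truncn (r / s)).+1%:R)); first by rewrite ltW// truncnS_gt.
  by rewrite -natrX ler_nat ltnW// ltn_expl.
elim: k r sr rR => [|k IH] r sr rR.
  rewrite expr0 mul1r => rs; have -> : s = r by apply/eqP; rewrite eq_le sr.
  by rewrite subrr normr0.
move=> rks.
have r0 : 0 < r by exact: lt_le_trans sr.
(* The ratio r / s need not be a power of 2: once it is at most 2 a single step reaches [s];
   otherwise r / 2 still exceeds [s] and the induction applies to it. *)
have [rs|rs] := leP r (2 * s).
  apply: (@le_trans _ _ (K1 * A * r `^ th)); last first.
    by rewrite ler_wpM2r ?powR_ge0// ler_wpM2r.
  apply: mean_step => //; first by lra.
  by move=> z [Oz /= xz]; split => //=; lra.
have h1 : `|a x s - a x (r / 2)| <= K2 * A * (r / 2) `^ th.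
  by apply: IH; [lra|lra|move: rks; rewrite exprS -mulrA; lra].
have h2 : `|a x (r / 2) - a x r| <= K1 * A * r `^ th.
  apply: mean_step => //; try by lra.
  by move=> z [Oz /= xz]; split => //=; lra.
apply: (le_trans (ler_distD (a x (r / 2)) _ _)).
apply: (le_trans (lerD h1 h2)).
rewrite powRM ?(ltW r0)//.
have -> : K1 = K2 * (1 - 2^-1 `^ th) by rewrite /K2 divfK// gt_eqF// subr_gt0.
by rewrite le_eqVlt; apply/orP; left; apply/eqP; ring.
Qed.

(** By [mean_chain] the intervals with centre [a x s] and half-length K2 A s^th meet pairwise: every
    left end lies below every right end. The supremum of the left ends therefore belongs to all of
    them, which gives the limit with its rate at once. *)
Lemma mean_limit x : O x -> exists u, forall s, 0 < s -> s <= R0 ->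
  `|a x s - u| <= K2 * A * s `^ th.
Proof.
move=> Ox.
pose S := [set a x s - K2 * A * s `^ th | s in [set s | 0 < s <= R0]].
have ub s : 0 < s -> s <= R0 -> ubound S (a x s + K2 * A * s `^ th).
  move=> s0 sR _ /= [t /andP[t0 tR] <-].
  have ps := K2A_ge0 s.
  have pt := K2A_ge0 t.
  have [st|ts] := leP s t.
    by have := mean_chain x t s Ox s0 st tR; rewrite ler_norml => /andP[]; lra.
  by have := mean_chain x s t Ox t0 (ltW ts) sR; rewrite ler_norml => /andP[]; lra.
have hS : has_sup S.
  split; first by exists (a x R0 - K2 * A * R0 `^ th), R0 => //=; rewrite R0_gt0 lexx.
  by exists (a x R0 + K2 * A * R0 `^ th); exact: ub.
exists (sup S) => s s0 sR.
have h1 : sup S <= a x s + K2 * A * s `^ th by apply: ge_sup; [case: hS|exact: ub].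
have h2 : a x s - K2 * A * s `^ th <= sup S.
  by apply: sup_upper_bound => //; exists s => //=; rewrite s0.
rewrite ler_norml; apply/andP; split; lra.
Qed.

Lemma exists_small_radius (t : R) : 0 < t ->
  exists r, [/\ 0 < r, 4 * r <= R0 & r `^ th <= t].
Proof.
move=> t0; have m0 : 0 < Num.min (R0 / 4) (t `^ th^-1).
  by rewrite lt_min powR_gt0// divr_gt0.
exists (Num.min (R0 / 4) (t `^ th^-1)); split => //.
- by rewrite -ler_pdivlMl// mulrC ge_min lexx.
- apply: (@le_trans _ _ ((t `^ th^-1) `^ th)).
    by apply: le_powR; [exact: ltW..|rewrite ge_min lexx orbT].
  by rewrite -powRrM mulVf ?gt_eqF// powRr1// ltW.
Qed.

(** The Holder bound comes first, because the almost everywhere equality uses it to compare [u] at a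
    point with [u] at the centre of a covering ball. *)
Lemma campanato : O !=set0 -> exists u : T -> R,
  {ae mu, forall x, O x -> u x = f x} /\
  forall x y s, O x -> O y -> 0 < s -> 4 * s <= R0 -> dist x y <= s ->
    `|u x - u y| <= K3 * A * s `^ th.
Proof.
move=> One.
have /choice[u Hu] (x : T) : exists v, O x -> forall s, 0 < s -> s <= R0 ->
    `|a x s - v| <= K2 * A * s `^ th.
  by have [/mean_limit[v Hv]|nOx] := pselect (O x); [exists v|exists 0].
have hol x y s : O x -> O y -> 0 < s -> 4 * s <= R0 -> dist x y <= s ->
    `|u x - u y| <= K3 * A * s `^ th.
  move=> Ox Oy s0 sR xy.
  have sR' : s <= R0 by lra.
  have s40 : 0 < 4 * s by lra.
  have := Hu x Ox (4 * s) s40 sR.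
  have := Hu y Oy s s0 sR'.
  have := mean_step x y (4 * s) s Ox Oy s0 _ sR (lexx _) (ball_sub x y s xy s0).
  move=> /(_ ltac:(lra)).
  rewrite /K3 powRM ?(ltW s0)// !ler_norml => /andP[? ?] /andP[? ?] /andP[? ?].
  apply/andP; split; lra.
exists u; split => //.
(* The set where [f] and [u] differ is the countable union of the [B k]; each [B k] is enclosed in
   measurable sets of measure at most any given [e]. *)
pose B (k : nat) := [set y | O y /\ k.+1%:R^-1 <= `|f y - u y|].
apply: (@negligibleS _ _ _ _ (\bigcup_k B k)).
  move=> y /= ny.
  have [Oy nfy] : O y /\ u y <> f y.
    by split; [apply: contrapT => nO|move=> e]; apply: ny.
  have p0 : 0 < `|f y - u y|.
    by rewrite normr_gt0 subr_eq0; apply/eqP => e; apply: nfy.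
  exists (Num.truncn `|f y - u y|^-1) => //; split => //.
  by rewrite invf_ple ?posrE// ltW// truncnS_gt.
apply: negligible_bigcup => k; apply: negligible_small => e e0.
set eps : R := k.+1%:R^-1.
have eps0 : 0 < eps by rewrite invr_gt0.
have K3_gt0 := holder_const_gt0.
(* The radius will satisfy q1 r^th <= eps / 2, which keeps [u] on each ball within eps / 2 of the
   mean of [f] there, and W r^th <= e, which bounds the total measure. The summands 1 keep [q1] and
   [W] positive when [A] is 0. *)
pose q1 := (K2 + K3) * A + 1.
have q10 : 0 < q1 by rewrite ltr_wpDl// mulr_ge0// ltW// addr_gt0.
pose g : R := (eps / 2)^-1.
have g0 : 0 < g by rewrite invr_gt0 divr_gt0.
pose W := g * A * C * (2 `^ nu / c * fine (mu O)) + 1.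
have W0 : 0 < W.
  apply: ltr_wpDl => //; apply: mulr_ge0.
    by apply: mulr_ge0; [apply: mulr_ge0 => //|]; exact: ltW.
  apply: mulr_ge0; last exact: fine_ge0.
  by apply: divr_ge0; [exact: powR_ge0|exact: ltW].
pose t := Num.min (eps / 2 / q1) (e / W).
have t0 : 0 < t by rewrite lt_min !divr_gt0.
have [r [r0 rR rt]] := exists_small_radius t t0.
have rR' : r <= R0 by lra.
have [N [x [xO cov cnt]]] := separated_net r r0 rR' One.
(* Replacing [u] by the constant mean makes these sets measurable, through [f] alone, and puts them
   within reach of Markov's inequality; they still cover [B k]. *)
pose V i := E (x i) r `&` [set y | eps / 2 <= `|f y - a (x i) r|].
have mV i : measurable (V i).
  have mf : measurable_fun (E (x i) r) (fun y => `|f y - a (x i) r|).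
    apply: measurableT_comp => //; apply: measurable_funB => //.
    exact/measurable_EFinP/(measurable_int mu (fiE _ _)).
  rewrite (_ : V i = E (x i) r `&` (fun y => `|f y - a (x i) r|) @^-1` `[eps / 2, +oo[).
    exact: mf.
  by apply/seteqP; split => z [Ez /= h]; split => //; move: h; rewrite /= in_itv/= andbT.
exists (\big[setU/set0]_(i < N) V i); split.
- exact: bigsetU_measurable.
- move=> y [Oy yeps]; have := cov y Oy; rewrite -(bigcup_mkord N V).
  rewrite -(bigcup_mkord N (fun i => E (x i) r)) => -[i /= iN Ey].
  exists i => //; split => //=.
  have Oxi := xO i iN.
  have d1 : `|a (x i) r - u (x i)| <= K2 * A * r `^ th by exact: Hu.
  have d2 : `|u (x i) - u y| <= K3 * A * r `^ th.
    by apply: hol => //; rewrite ltW//; case: Ey.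
  have d3 : q1 * r `^ th <= eps / 2.
    rewrite mulrC -ler_pdivlMr//; apply: (le_trans rt).
    by rewrite /t ge_min lexx.
  have d4 : K2 * A * r `^ th + K3 * A * r `^ th <= q1 * r `^ th.
    rewrite -mulrDl ler_wpM2r ?powR_ge0// /q1; lra.
  have d5 := ler_distD (a (x i) r) (f y) (u y).
  have d6 := ler_distD (u (x i)) (a (x i) r) (u y).
  move: yeps; rewrite -/eps; lra.
- apply: (@le_trans _ _ (\sum_(i < N) mu (V i))%E).
    by apply: Boole_inequality => i _; exact: mV.
  apply: (@le_trans _ _
    (\sum_(i < N) ((eps / 2)^-1 * (C * r `^ nu) * (A * r `^ th))%R%:E)%E).
    apply: lee_sum => i _; have Oxi := xO i (ltn_ord i).
    apply: (le_trans (markov_mean _ _ _ mu (E (x i) r) f (a (x i) r) (eps / 2)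
      _ _ _ _ _)) => //.
    + exact: E_gt0.
    + by rewrite divr_gt0.
    + rewrite lee_fin ler_pM//.
      * by rewrite mulr_ge0 ?invr_ge0 ?fine_ge0// ltW// divr_gt0.
      * exact: mean_ge0.
      * by rewrite ler_pM2l ?invr_gt0 ?divr_gt0//; exact: ball_upper.
      * exact: osc.
  rewrite sumEFin lee_fin sumr_const card_ord -[leLHS]mulr_natl.
  have : W * r `^ th <= e.
    rewrite mulrC -ler_pdivlMr//; apply: (le_trans rt).
    by rewrite /t ge_min lexx orbT.
  apply: le_trans; rewrite -/g.
  (* The number of balls grows like r^(-nu), which [cnt] balances against their volume r^nu; the
     oscillation factor r^th remains and makes the sum small. *)
  rewrite (_ : N%:R * _ = g * A * C * (N%:R * r `^ nu) * r `^ th); last by ring.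
  apply: ler_wpM2r; first exact: powR_ge0.
  apply: ler_wpDr => //; apply: ler_wpM2l => //.
  by apply: mulr_ge0; [apply: mulr_ge0 => //|]; exact: ltW.
Qed.

End campanato.

(** * Borel sets of R^n and the quasi-metric [delta_g] *)

Section anisotropic_geometry.
Context (R : realType) (n : nat).
Local Notation Rn := 'rV[R]_n.
Implicit Types (x y z : Rn) (r : R).

Lemma measurable_coord (i : 'I_n) :
  measurable_fun [set: Rn] (fun x : Rn => x ord0 i).
Proof.
move=> _ Y mY; rewrite setTI; apply: sub_sigma_algebra => /=.
rewrite -bigcup_seq/=; exists i => /=; first by rewrite mem_index_enum.
by exists Y => //; rewrite setTI.
Qed.

Lemma measurable_forall_coord (P : 'I_n -> set R) :
  (forall i, measurable (P i)) ->
  measurable [set x : Rn | forall i, P i (x ord0 i)].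
Proof.
move=> mP.
rewrite [X in measurable X](_ : _ =
    \bigcap_(i in [set: 'I_n]) [set x : Rn | P i (x ord0 i)]).
  apply: fin_bigcap_measurable => // i _.
  by have := measurable_coord i measurableT _ (mP i); rewrite setTI.
by apply/seteqP; split => [x h i _|x h i]; exact: h.
Qed.

Lemma ball_rV x y r : ball x r y <-> 0 < r /\ forall i, `|x ord0 i - y ord0 i| < r.
Proof.
split=> [[r0 h]|[r0 h]]; split=> //.
  by move=> i; exact: (h ord0 i).
by move=> i j; rewrite (ord1 i); exact: h.
Qed.

(** The sigma-algebra is generated by the coordinates, so [A] is written as a countable union of
    open cubes with rational centre and half-side 1 / (k + 1); [F] discards the cubes that are not
    contained in [A]. *)
Lemma open_measurable_rV (A : set Rn) : open A -> measurable A.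
Proof.
move=> oA.
pose B (q : 'rV[rat]_n * nat) : set Rn :=
  [set x | forall i, `|ratr (q.1 ord0 i) - x ord0 i| < q.2.+1%:R^-1].
pose F q := if pselect (B q `<=` A) then B q else set0.
rewrite (_ : A = \bigcup_q F q).
  apply: countable_bigcupT_measurable; first exact: countableP.
  move=> q; rewrite /F; case: pselect => [h|h]; last exact: measurable0.
  apply: (measurable_forall_coord
    (fun i => [set t | `|ratr (q.1 ord0 i) - t| < q.2.+1%:R^-1])) => i.
  rewrite [X in measurable X](_ : _ = ball (ratr (q.1 ord0 i) : R) q.2.+1%:R^-1) //.
  exact: measurable_ball.
apply/seteqP; split => [x Ax|x [q _]]; last first.
  by rewrite /F; case: pselect => [h|] //; exact: h.
have := open_nbhs_nbhs (conj oA Ax).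
rewrite -nbhs_ballE => -[e /= e0 eA].
(* A cube of half-side [w] whose centre is within [w] of [x] stays within 2 w < e of [x]. *)
have [k [w [kw w0 we]]] : exists k (w : R), [/\ k.+1%:R^-1 = w, 0 < w & w < e / 2].
  exists (Num.truncn (e / 2)^-1); eexists; split; [by []|by rewrite invr_gt0|].
  by rewrite invf_plt ?posrE ?divr_gt0// truncnS_gt.
have /choice[q qP] (i : 'I_n) : exists q : rat, `|ratr q - x ord0 i| < w.
  have [q] : exists q : rat, ratr q \in `]x ord0 i - w, x ord0 i + w[.
    by apply: rat_in_itvoo; lra.
  rewrite in_itv/= => /andP[h1 h2]; exists q.
  by rewrite ltr_norml; apply/andP; split; lra.
exists (\row_i q i, k) => //; rewrite /F; case: pselect => h.
  by move=> i /=; rewrite mxE kw.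
exfalso; apply: h => y By; apply: eA; apply/ball_rV; split => // i.
have := By i; rewrite /= mxE kw => h1.
have := ler_distD (ratr (q i)) (x ord0 i) (y ord0 i).
rewrite [`|x ord0 i - ratr _|]distrC; have := qP i; lra.
Qed.

Lemma bar_dist_ge0 x y : 0 <= bar_dist x y.
Proof. exact: sqrtr_ge0. Qed.

Lemma bar_distC x y : bar_dist x y = bar_dist y x.
Proof.
by congr Num.sqrt; apply: eq_bigr => i _; rewrite -sqrrN opprB.
Qed.

(** Applying (a + b)^2 <= 2 a^2 + 2 b^2 in each coordinate bounds the squared distance by 4 m^2,
    where [m] is the maximum on the right. *)
Lemma bar_dist_quasi x y z :
  bar_dist x z <= 2 * Num.max (bar_dist x y) (bar_dist y z).
Proof.
set m := Num.max _ _.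
have m0 : 0 <= m by rewrite le_max bar_dist_ge0.
rewrite -[leRHS]ger0_norm ?mulr_ge0// -sqrtr_sqr ler_wsqrtr//.
set S := fun u v : Rn => \sum_(i < n | val i != n.-1) (u ord0 i - v ord0 i) ^+ 2.
have S0 u v : 0 <= S u v by apply: sumr_ge0 => i _; exact: sqr_ge0.
have SE u v : S u v = bar_dist u v ^+ 2 by rewrite /bar_dist -/(S u v) sqr_sqrtr.
apply: (@le_trans _ _ (2 * S x y + 2 * S y z)).
  rewrite !mulr_sumr -big_split/=; apply: ler_sum => i _.
  have := sqr_ge0 ((x ord0 i - y ord0 i) - (y ord0 i - z ord0 i)); nra.
have h u v : bar_dist u v <= m -> S u v <= m ^+ 2.
  by move=> h; rewrite SE lerXn2r// nnegrE bar_dist_ge0.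
have h1 : S x y <= m ^+ 2 by apply: h; rewrite le_max lexx.
have h2 : S y z <= m ^+ 2 by apply: h; rewrite le_max lexx orbT.
by nra.
Qed.

Context (g : R) (g_gt0 : 0 < g) (g_le1 : g <= 1).

Lemma delta_gC x y : delta_g g x y = delta_g g y x.
Proof. by rewrite /delta_g bar_distC distrC. Qed.

(** For the first n - 1 coordinates, (2 b)^g = 2^g b^g <= 2 b^g because [g <= 1], so the power
    preserves the constant 2. The last coordinate obeys the ordinary triangle inequality. *)
Lemma delta_g_quasi x y z :
  delta_g g x z <= 2 * Num.max (delta_g g x y) (delta_g g y z).
Proof.
set m := Num.max _ _.
have mge u v : delta_g g u v <= m ->
    bar_dist u v `^ g <= m /\ `|xlast u - xlast v| <= m.
  by rewrite ge_max => /andP[].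
have [xy1 xy2] : bar_dist x y `^ g <= m /\ `|xlast x - xlast y| <= m.
  by apply: mge; rewrite le_max lexx.
have [yz1 yz2] : bar_dist y z `^ g <= m /\ `|xlast y - xlast z| <= m.
  by apply: mge; rewrite le_max lexx orbT.
rewrite ge_max; apply/andP; split; last first.
  by have := ler_distD (xlast y) (xlast x) (xlast z); lra.
set b := Num.max (bar_dist x y) (bar_dist y z).
have b0 : 0 <= b by rewrite le_max bar_dist_ge0.
have bm : b `^ g <= m by rewrite /b; have [_|_] := leP (bar_dist x y) (bar_dist y z).
apply: (@le_trans _ _ ((2 * b) `^ g)).
  apply: ge0_ler_powR; rewrite ?nnegrE ?bar_dist_ge0 ?mulr_ge0//.
    exact: ltW.
  exact: bar_dist_quasi.
rewrite powRM//; apply: ler_pM => //; rewrite ?powR_ge0//.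
by apply: ler1_powR => //; rewrite ler1n.
Qed.

Lemma measurable_delta_g x : measurable_fun [set: Rn] (delta_g g x).
Proof.
have mc (i : 'I_n) := measurable_coord i.
have mb : measurable_fun [set: Rn] (fun y => bar_dist x y).
  have ms : measurable_fun [set: R] Num.sqrt.
    by apply: continuous_measurable_fun; exact: sqrt_continuous.
  apply: (measurableT_comp ms).
  under eq_fun do rewrite big_mkcond.
  apply: measurable_sum => i; case: (val i != n.-1); last exact: measurable_cst.
  by apply: measurable_funX; apply: measurable_funB.
have ml : measurable_fun [set: Rn] (fun y => xlast y).
  under eq_fun do rewrite /xlast big_mkcond.
  by apply: measurable_sum => i; case: (val i == n.-1).
apply: measurable_maxr.
  by apply: (measurableT_comp (measurable_powR g)).
by apply: measurableT_comp => //; apply: measurable_funB.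
Qed.

Lemma measurable_ball_g x r : measurable (ball_g g x r).
Proof.
have := measurable_delta_g x measurableT `]-oo, r[%classic.
by rewrite setTI => /(_ (measurable_itv _)).
Qed.

End anisotropic_geometry.

(** * Volume of anisotropic balls, and the diameter of a bounded open set *)

Section anisotropic_volume.
Context (R : realType) (m : nat).
Local Notation Rn := 'rV[R]_m.+1.
Context (mu : {measure set Rn -> \bar R}) (mu_leb : is_lebesgue_Rn mu).
Context (g : R) (g_gt0 : 0 < g).
Implicit Types (x y : Rn) (r : R) (O : set Rn).

Lemma xlastE x : xlast x = x ord0 ord_max.
Proof. by rewrite /xlast (big_pred1 ord_max). Qed.

Lemma coord_le_bar_dist x y (i : 'I_m.+1) : val i != m ->
  `|x ord0 i - y ord0 i| <= bar_dist x y.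
Proof.
move=> im; rewrite -sqrtr_sqr ler_wsqrtr//.
by rewrite (bigD1 i)//= lerDl sumr_ge0// => j _; exact: sqr_ge0.
Qed.

(** Half-sides of a box around the ball of radius [r]: a bar distance whose power [g] is below [r]
    is itself below r^(1/g). Index [m] is the last coordinate. *)
Definition box_side r (i : 'I_m.+1) : R := if val i == m then r else r `^ g^-1.

Lemma ball_g_coord x y r (i : 'I_m.+1) : ball_g g x r y ->
  `|x ord0 i - y ord0 i| < box_side r i.
Proof.
rewrite /ball_g/= gt_max => /andP[hb hl]; rewrite /box_side.
case: ifPn => [/eqP im|im].
  move: hl; rewrite !xlastE; have -> // : ord_max = i.
  exact/val_inj.
apply: (le_lt_trans (coord_le_bar_dist x y i im)).
have -> : bar_dist x y = (bar_dist x y `^ g) `^ g^-1.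
  by rewrite -powRrM mulfV ?gt_eqF// powRr1// bar_dist_ge0.
apply: gt0_ltr_powR; rewrite ?invr_gt0// nnegrE ?powR_ge0//.
by rewrite ltW// (le_lt_trans _ hb)// powR_ge0.
Qed.

(** [is_lebesgue_Rn] evaluates half-open boxes only, so [O] is enclosed in the one centred at [x]
    with half-sides [h]. This gives both the volume of balls and the finite measure of bounded
    sets. *)
Lemma measure_cube_le (O : set Rn) x (h : 'I_m.+1 -> R) : measurable O ->
  (forall i, 0 <= h i) ->
  (forall y i, O y -> `|x ord0 i - y ord0 i| < h i) ->
  (mu O <= (\prod_(i < m.+1) (2 * h i))%:E)%E.
Proof.
move=> mO h0 Oh.
pose a : Rn := \row_i (x ord0 i - h i).
pose b : Rn := \row_i (x ord0 i + h i).
have ab i : a ord0 i <= b ord0 i by rewrite !mxE; have := h0 i; lra.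
have := mu_leb a b ab.
rewrite (eq_bigr (fun i => 2 * h i)); last by move=> i _; rewrite !mxE; ring.
move=> <-; apply: le_measure; rewrite ?inE//.
  apply: (measurable_forall_coord R m.+1
    (fun i => [set t | a ord0 i <= t < b ord0 i])) => i.
  rewrite [X in measurable X](_ : _ = `[a ord0 i, b ord0 i[%classic)//.
move=> y Oy i; have := Oh y i Oy; rewrite !mxE ltr_norml => /andP[? ?].
by apply/andP; split; lra.
Qed.

(** The box has [m] half-sides r^(1/g) and one half-side [r], so the exponents add up to m / g + 1,
    which is [n_g]. *)
Lemma ball_g_volume x r : 0 < r ->
  (mu (ball_g g x r) <= (2 ^+ m.+1 * r `^ n_g m.+1 g)%:E)%E.
Proof.
move=> r0.
have -> : 2 ^+ m.+1 * r `^ n_g m.+1 g = \prod_(i < m.+1) (2 * box_side r i).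
  rewrite big_split/= prodr_const card_ord; congr (_ * _).
  rewrite big_ord_recr/= {2}/box_side eqxx.
  rewrite (eq_bigr (fun=> r `^ g^-1)); last first.
    by move=> i _; rewrite /box_side /= ltn_eqF.
  rewrite prodr_const card_ord -powR_mulrn ?powR_ge0// -powRrM.
  rewrite /n_g/= [g^-1 * _]mulrC powRD; last by rewrite (gt_eqF r0) implybT.
  by rewrite powRr1// ltW.
apply: measure_cube_le => //.
- exact: measurable_ball_g.
- by move=> i; rewrite /box_side; case: ifP => _; rewrite ?powR_ge0// ltW.
- by move=> y i; exact: ball_g_coord.
Qed.

Lemma bounded_coord O : bounded_set O ->
  exists2 M, 0 < M & forall y i, O y -> `|(0 : Rn) ord0 i - y ord0 i| < M.
Proof.
move=> /ex_strict_bound_gt0[M M0 HM]; exists M => // y i Oy.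
have : ball (0 : Rn) M y.
  by rewrite mx_norm_ball /ball_/= sub0r normrN; exact: HM.
by move=> /ball_rV[_]; exact.
Qed.

Lemma bounded_measure_fin O : measurable O -> bounded_set O -> (mu O < +oo)%E.
Proof.
move=> mO /bounded_coord[M M0 HM].
apply: (@le_lt_trans _ _ (\prod_(i < m.+1) (2 * M))%:E%E); last exact: ltry.
by apply: (measure_cube_le O 0 (fun=> M)) => // i; exact: ltW.
Qed.

Lemma bounded_delta_g O : bounded_set O ->
  exists L, forall x y, O x -> O y -> delta_g g x y <= L.
Proof.
move=> /bounded_coord[M M0 HM].
have H x y i : O x -> O y -> `|x ord0 i - y ord0 i| <= 2 * M.
  move=> Ox Oy; have := HM x i Ox; have := HM y i Oy.
  have := ler_distD ((0 : Rn) ord0 i) (x ord0 i) (y ord0 i).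
  by rewrite [`|x ord0 i - (0 : Rn) ord0 i|]distrC; lra.
exists (Num.max (Num.sqrt (\sum_(i < m.+1 | val i != m) (2 * M) ^+ 2) `^ g) (2 * M)).
move=> x y Ox Oy; rewrite /delta_g !xlastE.
have h1 : bar_dist x y `^ g <=
    Num.sqrt (\sum_(i < m.+1 | val i != m) (2 * M) ^+ 2) `^ g.
  apply: ge0_ler_powR; rewrite ?nnegrE ?sqrtr_ge0//; first exact: ltW.
  apply: ler_wsqrtr => //.
  apply: ler_sum => i _; rewrite -real_normK ?num_real//.
  by rewrite lerXn2r// ?nnegrE ?mulr_ge0 ?H// ltW.
by rewrite ge_max !le_max h1 H ?orbT.
Qed.

(** [sup] is an upper bound only for sets that are bounded above; boundedness of [O] supplies
    this. *)
Lemma delta_g_le_diam O x y : bounded_set O -> O x -> O y ->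
  delta_g g x y <= diam_g g O.
Proof.
move=> /bounded_delta_g[L HL] Ox Oy.
apply: sup_upper_bound; last by exists x => //; exists y.
split; first by exists (delta_g g x y), x => //; exists y.
by exists L => _ [u Ou [v Ov <-]]; exact: HL.
Qed.

Lemma diam_g_gt0 O : open O -> O !=set0 -> bounded_set O -> 0 < diam_g g O.
Proof.
move=> oO [x Ox] bO.
have := open_nbhs_nbhs (conj oO Ox).
rewrite -nbhs_ballE => -[e /= e0 eO].
(* A diagonal shift stays in the cube of half-side [e], and its last coordinate alone makes
   [delta_g] positive. *)
pose y : Rn := x + \row_i (e / 2).
have Oy : O y.
  apply: eO; apply/ball_rV; split => // i.
  rewrite !mxE opprD addrA subrr sub0r normrN gtr0_norm ?divr_gt0//; lra.
apply: (lt_le_trans _ (delta_g_le_diam O x y bO Ox Oy)).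
rewrite lt_max; apply/orP; right; rewrite !xlastE !mxE opprD addrA subrr sub0r.
by rewrite normrN normr_gt0 gt_eqF// divr_gt0.
Qed.

Lemma delta_g_eq0 x y : delta_g g x y <= 0 -> x = y.
Proof.
rewrite ge_max => /andP[hb hl]; apply/rowP => i; apply/eqP.
rewrite -subr_eq0 -normr_le0.
have [im|im] := eqVneq (val i) m.
  by move: hl; rewrite !xlastE; have -> : ord_max = i by exact/val_inj.
apply: (le_trans (coord_le_bar_dist x y i im)).
have : bar_dist x y `^ g == 0 by rewrite eq_le hb powR_ge0.
by rewrite powR_eq0 => /andP[/eqP -> _].
Qed.

End anisotropic_volume.

(** * Consequences of finite Morrey norms for [f] and its gradient *)

Section morrey_estimates.
Context (R : realType) (m : nat).
Local Notation Rn := 'rV[R]_m.+1.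
Context (mu : {measure set Rn -> \bar R}) (g lam p : R) (O : set Rn).
Context (mO : measurable O) (One : O !=set0) (Ofin : (mu O < +oo)%E).
Context (p_ge1 : 1 <= p).
Implicit Types (f h : Rn -> R) (G : 'I_m.+1 -> Rn -> R).

Let p_gt0 : 0 < p. Proof. by rewrite (lt_le_trans ltr01). Qed.

Lemma measurable_normpow f : measurable_fun O f ->
  measurable_fun O (fun x => (`|f x| `^ p)%:E).
Proof.
move=> mf; apply/measurable_EFinP; apply: (measurableT_comp (measurable_powR p)).
exact: measurableT_comp.
Qed.

(** On a set of finite measure, |f| <= 1 + |f|^p suffices. *)
Lemma Lp_integrable f : Lp mu p O f -> mu.-integrable O (EFin \o f).
Proof.
move=> [mf fp]; apply/integrableP; split; first exact/measurable_EFinP.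
apply: (@le_lt_trans _ _ (\int[mu]_(x in O) (1 + (`|f x| `^ p)%:E))%E).
  apply: ge0_le_integral => //.
  - by apply/measurable_EFinP; exact: measurableT_comp.
  - by apply: emeasurable_funD => //; exact: measurable_normpow.
  - move=> x _; rewrite /= -EFinD lee_fin.
    have [f1|f1] := leP `|f x| 1; first by rewrite (le_trans f1)// lerDl powR_ge0.
    by rewrite ler_wpDl// le1r_powR// ltW.
rewrite ge0_integralD//; last exact: measurable_normpow.
by rewrite integral_cst// mul1e lte_add_pinfty.
Qed.

(** A point of [O] and the radius 1 exhibit a nonnegative member; over an empty [O] the supremum
    would be [-oo]. *)
Lemma morrey_norm_ge0 h : (0 <= morrey_norm mu lam p g O h)%E.
Proof.
have [x Ox] := One; apply: (le_trans (poweR_ge0 _ p^-1)).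
by apply: ereal_sup_ubound; exists x => //; exists 1 => //=.
Qed.

(** Raising the defining bound to the power [p] undoes the root, and the minimum of r^lam and 1 is
    at most r^lam. *)
Lemma le_morrey_integral h (M : R) x (r : R) : O x -> 0 < r ->
  (morrey_norm mu lam p g O h <= M%:E)%E ->
  (\int[mu]_(y in O `&` ball_g g x r) (`|h y| `^ p)%:E
    <= (M `^ p * r `^ lam)%:E)%E.
Proof.
move=> Ox r0 hM; rewrite setIC.
set I := (\int[mu]_(y in _) _)%E.
have I0 : (0 <= I)%E by apply: integral_ge0 => y _; rewrite lee_fin powR_ge0.
set q := Num.min (r `^ lam) 1.
have q0 : 0 < q by rewrite lt_min powR_gt0//= ltr01.
have M0 : 0 <= M.
  by rewrite -lee_fin; apply: le_trans hM; exact: morrey_norm_ge0.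
have h1 : (poweR (q^-1%:E * I) p^-1 <= M%:E)%E.
  apply: le_trans hM; apply: ereal_sup_ubound.
  by exists x => //; exists r.
have X0 : (0 <= q^-1%:E * I)%E by rewrite mule_ge0// lee_fin invr_ge0 ltW.
have h2 : (q^-1%:E * I <= (M `^ p)%:E)%E.
  rewrite -(poweRe1 X0) -[X in poweR _ X](mulVf (lt0r_neq0 p_gt0)).
  rewrite poweRrM -poweR_EFin.
  apply: gt0_ler_poweR => //; first exact: ltW.
    by rewrite in_itv/= leey andbT poweR_ge0.
  by rewrite in_itv/= leey andbT lee_fin.
have h3 : (I <= (q * M `^ p)%:E)%E by rewrite EFinM -lee_pdivrMl.
apply: (le_trans h3); rewrite lee_fin mulrC ler_wpM2l ?powR_ge0//.
by rewrite ge_min lexx.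
Qed.

(** The Euclidean norm is at most m + 1 times the largest component, whose power [p] is one term of
    the sum on the right. *)
Lemma grad_norm_pow_le G y :
  grad_norm G y `^ p <= m.+1%:R `^ p * \sum_(i < m.+1) `|G i y| `^ p.
Proof.
have [j _ jmax] := @Order.TotalTheory.arg_maxP _ _ 'I_m.+1 ord0 xpredT
  (fun i => `|G i y|) isT.
have h : grad_norm G y <= m.+1%:R * `|G j y|.
  rewrite -[leRHS]ger0_norm ?mulr_ge0// -sqrtr_sqr ler_wsqrtr//.
  apply: (@le_trans _ _ (\sum_(i < m.+1) `|G j y| ^+ 2)).
    apply: ler_sum => i _; rewrite -real_normK ?num_real//.
    by rewrite lerXn2r ?nnegrE//; exact: jmax.
  rewrite sumr_const card_ord -[leLHS]mulr_natl exprMn ler_wpM2r ?sqr_ge0//.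
  by rewrite -natrX ler_nat leq_pmulr.
apply: (@le_trans _ _ ((m.+1%:R * `|G j y|) `^ p)).
  by apply: ge0_ler_powR; rewrite ?nnegrE ?sqrtr_ge0 ?mulr_ge0// ltW.
by rewrite powRM// ler_wpM2l ?powR_ge0// (bigD1 j)//= lerDl sumr_ge0.
Qed.

Lemma fine_le_EFin (X : \bar R) (b : R) : (0 <= X)%E -> (X <= b%:E)%E -> fine X <= b.
Proof. by case: X. Qed.

Lemma grad_integral_le G (M : R) x (r : R) : O x -> 0 < r ->
  (forall i, measurable_fun O (G i)) ->
  (forall i, morrey_norm mu lam p g O (G i) <= M%:E)%E ->
  Rintegral mu (O `&` ball_g g x r) (fun y => grad_norm G y `^ p) <=
  m.+1%:R `^ p * m.+1%:R * (M `^ p * r `^ lam).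
Proof.
move=> Ox r0 mG GM.
set F := O `&` _.
have mF : measurable F by apply: measurableI => //; exact: measurable_ball_g.
have mGF i : measurable_fun F (G i).
  by apply: (measurable_funS mO) => //; exact: subIsetl.
have mGp i : measurable_fun F (fun y => (`|G i y| `^ p)%:E).
  apply/measurable_EFinP; apply: (measurableT_comp (measurable_powR p)).
  exact: measurableT_comp.
apply: fine_le_EFin; first by apply: integral_ge0 => y _; rewrite lee_fin powR_ge0.
apply: (@le_trans _ _ (\int[mu]_(y in F)
    ((m.+1%:R `^ p)%:E * \sum_(i < m.+1) (`|G i y| `^ p)%:E))%E).
  apply: ge0_le_integral => //.
  - by move=> y _; rewrite lee_fin powR_ge0.
  - apply/measurable_EFinP; apply: (measurableT_comp (measurable_powR p)).
    have ms : measurable_fun [set: R] Num.sqrt.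
      by apply: continuous_measurable_fun; exact: sqrt_continuous.
    apply: (measurableT_comp ms); apply: measurable_sum => i.
    exact: measurable_funX.
  - by apply: measurable_funeM; apply: emeasurable_sum.
  - by move=> y _; rewrite sumEFin -EFinM lee_fin grad_norm_pow_le.
have sm : measurable_fun F (fun y => \sum_(i < m.+1) (`|G i y| `^ p)%:E)%E.
  exact: emeasurable_sum.
have s0 y : F y -> (0 <= \sum_(i < m.+1) (`|G i y| `^ p)%:E)%E.
  by move=> _; apply: sume_ge0 => i _; rewrite lee_fin powR_ge0.
rewrite ge0_integralZl//.
rewrite ge0_integral_sum//.
rewrite -mulrA EFinM lee_wpmul2l ?lee_fin ?powR_ge0//.
apply: (@le_trans _ _ (\sum_(i < m.+1) (M `^ p * r `^ lam)%:E)%E).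
  by apply: lee_sum => i _; exact: le_morrey_integral.
by rewrite sumEFin lee_fin sumr_const card_ord mulr_natl.
Qed.

(** [fine] would send an infinite norm to 0; membership in the space makes the norm finite, so that
    the real number [M] does dominate each component. *)
Lemma W1lam_norm_bounds f G : in_W1lam mu lam p g O f G ->
  let M := fine (W1lam_norm mu lam p g O f G) in
  0 <= M /\ forall i, (morrey_norm mu lam p g O (G i) <= M%:E)%E.
Proof.
move=> [_ [[_ fM] GM]] M.
have sge0 : (0 <= \sum_(i < m.+1) morrey_norm mu lam p g O (G i))%E.
  by apply: sume_ge0 => i _; exact: morrey_norm_ge0.
have W0 : (0 <= W1lam_norm mu lam p g O f G)%E.
  by apply: adde_ge0 => //; exact: morrey_norm_ge0.
split; first exact: fine_ge0.
move=> i; rewrite fineK; last first.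
  rewrite ge0_fin_numE//; apply: lte_add_pinfty => //.
  by apply: lte_sum_pinfty => j _; case: (GM j).
apply: (@le_trans _ _ (\sum_(i < m.+1) morrey_norm mu lam p g O (G i))%E).
  rewrite (bigD1 i)//= leeDl//; apply: sume_ge0 => j _; exact: morrey_norm_ge0.
by rewrite leeDr// morrey_norm_ge0.
Qed.

End morrey_estimates.

(** * From the Poincare inequality to the Campanato condition and the Holder bound *)

Theorem theorem2p7 (R : realType) (n : nat)
    (mu : {measure set 'rV[R]_n -> \bar R}) (Hmu : is_lebesgue_Rn mu)
    (gam p : R) (Omega : set 'rV[R]_n)
    (Hn : (2 <= n)%N) (Hgam0 : 0 < gam) (Hgam1 : gam <= 1) (Hp : 1 <= p)
    (HOopen : open Omega) (HOconn : connected Omega) (HOne : Omega !=set0)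
    (HObdd : bounded_set Omega)
    (c0 : R) (Hc0 : 0 < c0)
    (Hreg : forall x r, closure Omega x -> 0 < r -> r <= diam_g gam Omega ->
       (mu (ball_g gam x r `&` Omega) >= (c0 * r `^ n_g n gam)%:E)%E)
    (tau eta cp : R) (Htau : 1 <= tau) (Heta : 0 < eta) (Hcp : 0 < cp)
    (Hpoinc : forall (f : 'rV[R]_n -> R) (g : 'I_n -> 'rV[R]_n -> R),
       W1p mu p Omega f g ->
       forall x r, Omega x -> 0 < r ->
       let E := Omega `&` ball_g gam x r in
       let Et := Omega `&` ball_g gam x (tau * r) in
       avg mu E (fun y => `|f y - avg mu E f|) <=
       cp * r `^ eta * (avg mu Et (fun y => grad_norm g y `^ p)) `^ p^-1)
    (lam : R) (Hlam : 0 < lam) (Hlam2 : p * eta > n_g n gam - lam) :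
  exists c : R, 0 < c /\
    forall (f : 'rV[R]_n -> R) (g : 'I_n -> 'rV[R]_n -> R),
      in_W1lam mu lam p gam Omega f g ->
      exists f' : 'rV[R]_n -> R,
        {ae mu, forall x, Omega x -> f' x = f x} /\
        forall x y, Omega x -> Omega y ->
          `|f' x - f' y| <=
          c * fine (W1lam_norm mu lam p gam Omega f g) *
          (bar_dist x y `^ gam + `|xlast x - xlast y|)
            `^ (eta + (lam - n_g n gam) / p).
Proof.
case: n mu Hmu Omega Hn HOopen HOconn HOne HObdd Hreg Hpoinc Hlam2
  => [//|m] {}mu {}Hmu O _ oO _ One bO {}Hreg {}Hpoinc {}Hlam2.
have p_gt0 : 0 < p by rewrite (lt_le_trans ltr01).
have mO := open_measurable_rV R m.+1 O oO.
have Ofin := bounded_measure_fin R m mu Hmu O mO bO.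
set nu := n_g m.+1 gam in Hreg Hlam2 *.
set D := diam_g gam O in Hreg.
have D_gt0 : 0 < D by exact: diam_g_gt0.
have nu_gt0 : 0 < nu by rewrite ltr_wpDl// divr_ge0// ltW.
set th := eta + (lam - nu) / p.
have th_gt0 : 0 < th.
  have -> : th = (p * eta - (nu - lam)) / p.
    by rewrite /th; field; rewrite gt_eqF.
  by rewrite divr_gt0// subr_gt0.
(* [campanato] will be used with threshold 4 D, so that its condition [4 * s <= R0] admits every
   distance s <= D in [O]. Comparing radius [r] with r / 4 <= D extends the lower volume bound to r
   <= 4 D, at the price of the factor 4^(-nu). *)
pose c := c0 * 4^-1 `^ nu.
have c_gt0 : 0 < c by rewrite mulr_gt0// powR_gt0.
pose C : R := 2 ^+ m.+1.
have C_gt0 : 0 < C by rewrite exprn_gt0.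
have mB (x : 'rV[R]_m.+1) r : measurable (ball_g gam x r) by exact: measurable_ball_g.
have mE x r : measurable (O `&` ball_g gam x r) by exact: measurableI.
have Efin x r : mu (O `&` ball_g gam x r) \is a fin_num.
  by apply: (fin_num_measure_sub _ _ _ mu O) => //; exact: subIsetl.
have lower x (r : R) : O x -> 0 < r -> r <= 4 * D ->
    c * r `^ nu <= fine (mu (O `&` ball_g gam x r)).
  move=> Ox r0 rD.
  have r40 : 0 < r / 4 by rewrite divr_gt0.
  have r4D : r / 4 <= D by lra.
  have := Hreg x (r / 4) (subset_closure Ox) r40 r4D.
  have -> : c0 * (r / 4) `^ nu = c * r `^ nu.
    by rewrite powRM ?(ltW r0)// /c mulrAC -mulrA.
  rewrite setIC => h.
  apply: (@le_trans _ _ (fine (mu (O `&` ball_g gam x (r / 4))))).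
    by rewrite -lee_fin fineK.
  apply: le_fine_measure => //.
    by move=> y [Oy]; rewrite /ball_g/= => h'; split => //=; lra.
  by rewrite -ge0_fin_numE.
have upper x (r : R) : O x -> 0 < r -> r <= 4 * D ->
    fine (mu (O `&` ball_g gam x r)) <= C * r `^ nu.
  move=> Ox r0 _; apply: fine_le_EFin => //.
  apply: le_trans (ball_g_volume R m mu Hmu gam Hgam0 x r r0).
  apply: le_measure; [rewrite inE; exact: mE|rewrite inE; exact: mB|].
  exact: subIsetr.
(* The mean of the gradient's power [p] over the ball of radius tau r will be at most K M^p r^(lam -
   nu): the factors come from the volume bound, from the components of the gradient, and from the
   dilation by [tau]. *)
pose K := c^-1 * (m.+1%:R `^ p * m.+1%:R) * tau `^ lam.
have tau_gt0 : 0 < tau by rewrite (lt_le_trans ltr01).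
have K_gt0 : 0 < K.
  by rewrite !mulr_gt0 ?invr_gt0 ?powR_gt0// ltr0n.
have K3_gt0 := holder_const_gt0 R c C nu th c_gt0 C_gt0 th_gt0.
set K3 := holder_const _ _ _ _ _ in K3_gt0.
(* The Campanato bound is linear in [A], which is proportional to the norm [M]; taking [M] out
   leaves a constant independent of [f] and [G]. *)
exists (K3 * (cp * K `^ p^-1)); split.
  by rewrite mulr_gt0// mulr_gt0// powR_gt0.
move=> f G fG.
have [M_ge0 GM] := W1lam_norm_bounds R m mu gam lam p O One f G fG.
set M := fine _ in M_ge0 GM *.
have [wfG [[Lf _] LG]] := fG.
pose A := cp * K `^ p^-1 * M.
have A_ge0 : 0 <= A.
  apply: mulr_ge0 => //; apply: mulr_ge0; first exact: ltW.
  exact: powR_ge0.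
have fW : W1p mu p O f G := conj Lf (conj (fun i => proj1 (LG i)) wfG).
have osc x (r : R) : O x -> 0 < r -> r <= 4 * D ->
    mean mu (O `&` ball_g gam x r)
      (fun y => `|f y - mean mu (O `&` ball_g gam x r) f|) <= A * r `^ th.
  move=> Ox r0 rD; apply: (le_trans (Hpoinc f G fW x r Ox r0)).
  have tr0 : 0 < tau * r by rewrite mulr_gt0.
  set Et := O `&` ball_g gam x (tau * r).
  have mEt : measurable Et by exact: mE.
  (* The radius tau r may exceed 4 D, so the lower bound is taken from the smaller ball of radius
     [r], contained in [Et] because [tau >= 1]. *)
  have Et_low : c * r `^ nu <= fine (mu Et).
    apply: (le_trans (lower x r Ox r0 rD)); apply: le_fine_measure => //.
      move=> y [Oy]; rewrite /ball_g/= => h; split => //=.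
      by apply: (lt_le_trans h); rewrite ler_peMl// ltW.
    by rewrite -ge0_fin_numE//; exact: Efin.
  have cr0 : 0 < c * r `^ nu by rewrite mulr_gt0// powR_gt0.
  have Et0 : 0 < fine (mu Et) by exact: lt_le_trans Et_low.
  have av : avg mu Et (fun y => grad_norm G y `^ p) <=
      K * (M `^ p * r `^ (lam - nu)).
    have -> : K * (M `^ p * r `^ (lam - nu)) = (c * r `^ nu)^-1 *
        (m.+1%:R `^ p * m.+1%:R * (M `^ p * (tau * r) `^ lam)).
      rewrite powRM ?(ltW tau_gt0) ?(ltW r0)//.
      rewrite powRB; last by rewrite (gt_eqF r0) implybT.
      by rewrite /K; field; rewrite !gt_eqF ?powR_gt0.
    apply: ler_pM.
    - by rewrite invr_ge0 ltW.
    - by apply: Rintegral_ge0 => y _; exact: powR_ge0.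
    - by rewrite lef_pV2.
    - apply: grad_integral_le => // i; by case: (LG i) => -[].
  (* The root turns r^(lam - nu) into r^((lam - nu) / p), which combines with r^eta from the
     Poincare inequality into r^th. *)
  have avp : avg mu Et (fun y => grad_norm G y `^ p) `^ p^-1 <=
      K `^ p^-1 * (M * r `^ ((lam - nu) / p)).
    apply: (@le_trans _ _ ((K * (M `^ p * r `^ (lam - nu))) `^ p^-1)).
      apply: ge0_ler_powR => //; rewrite ?nnegrE ?invr_ge0 ?(ltW p_gt0)//.
        by apply: mean_ge0 => y _; exact: powR_ge0.
      by apply: mulr_ge0; [exact: ltW|apply: mulr_ge0; exact: powR_ge0].
    have Mr_ge0 : 0 <= M `^ p * r `^ (lam - nu) by apply: mulr_ge0; exact: powR_ge0.
    rewrite (powRM _ (ltW K_gt0) Mr_ge0) powRM ?powR_ge0//.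
    by rewrite -!powRrM mulfV ?gt_eqF// powRr1.
  apply: (@le_trans _ _ (cp * r `^ eta * (K `^ p^-1 * (M * r `^ ((lam - nu) / p))))).
    by rewrite ler_wpM2l// mulr_ge0 ?powR_ge0// ltW.
  rewrite /th powRD; last by rewrite (gt_eqF r0) implybT.
  by rewrite le_eqVlt; apply/orP; left; apply/eqP; rewrite /A; ring.
have D4_gt0 : 0 < 4 * D by rewrite mulr_gt0.
have fint : mu.-integrable O (EFin \o f) by exact: (Lp_integrable R m mu p O).
have [u [uf uH]] := campanato _ _ R mu O (delta_g gam) (4 * D) c C nu th mO Ofin
  D4_gt0 c_gt0 C_gt0 nu_gt0 th_gt0 (delta_gC R m.+1 gam)
  (delta_g_quasi R m.+1 gam Hgam0 Hgam1) mB lower upper f A fint A_ge0 osc One.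
exists u; split => // x y Ox Oy.
have K3A : K3 * (cp * K `^ p^-1) * M = K3 * A by rewrite -[LHS]mulrA.
have K3A_ge0 : 0 <= K3 * A by apply: mulr_ge0 => //; exact: ltW.
set rho := bar_dist x y `^ gam + _; rewrite K3A.
have drho : delta_g gam x y <= rho.
  by rewrite ge_max /rho lerDl normr_ge0 lerDr powR_ge0.
(* [campanato] asks for a positive [s]; distance zero forces x = y. Otherwise s = [delta_g gam x y]
   is used, a maximum bounded by the sum [rho]. *)
have [d0|d0] := leP (delta_g gam x y) 0.
  rewrite (delta_g_eq0 R m gam x y d0) subrr normr0.
  by apply: mulr_ge0 => //; exact: powR_ge0.
have dD : 4 * delta_g gam x y <= 4 * D by rewrite ler_pM2l// delta_g_le_diam.
apply: (le_trans (uH x y _ Ox Oy d0 dD (lexx _))).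
apply: ler_wpM2l => //.
apply: ge0_ler_powR; rewrite ?nnegrE ?(ltW th_gt0) ?(ltW d0)//.
by rewrite (le_trans _ drho)// ltW.
Qed.
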